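(* Let $m_{3,3}(L_{3\text{-AP}})$ denote the limit, as $n\to\infty$, of the minimum over all $3$-colorings $\gamma:\mathbb{F}_3^n\to\{1,2,3\}$ of $s(\gamma^{(1)})+s(\gamma^{(2)})+s(\gamma^{(3)})$, where for $T\subseteq\mathbb{F}_3^n$ we set $s(T)=|\mathcal{S}(T)|/|\mathcal{S}(\mathbb{F}_3^n)|$ with $\mathcal{S}(T)=\{(a,a+d,a+2d)\in T^3: d\neq 0\}$ and $\gamma^{(i)}=\gamma^{-1}(i)$. Then $m_{3,3}(L_{3\text{-AP}})=1/27$.
   Context: $\mathbb{F}_q$ is the finite field with $q$ elements. A $c$-coloring of $\mathbb{F}_q^n$ is a map $\gamma:\mathbb{F}_q^n\to\{1,\dots,c\}$ and $\gamma^{(i)}$ is the set of elements of color $i$. The limit exists (by monotonicity). *)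

(* Defs.v *)
From mathcomp Require Import all_boot all_order all_algebra.
From mathcomp Require Import all_classical all_reals all_analysis.
Set Implicit Arguments.
Unset Strict Implicit.
Unset Printing Implicit Defensive.
Import Order.TTheory GRing.Theory Num.Theory.
Import numFieldNormedType.Exports.
Local Open Scope ring_scope.

Definition ap3 n (T : {set 'rV['F_3]_n}) :
    {set 'rV['F_3]_n * 'rV['F_3]_n * 'rV['F_3]_n} :=
  [set t in finset.setX (finset.setX T T) T |
    [exists a : 'rV['F_3]_n, exists d : 'rV['F_3]_n,
      (d != 0) && (t == (a, a + d, a + d *+ 2))]].

(* For n = 0 the denominator vanishes and the quotient is 0. *)
Definition ap3_density (R : realType) n (T : {set 'rV['F_3]_n}) : R :=
  #|ap3 T|%:R / #|ap3 [set: 'rV['F_3]_n]%SET|%:R.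

(* The colors 1, 2, 3 are represented by 0, 1, 2 : 'I_3. *)
Definition color_class n (g : {ffun 'rV['F_3]_n -> 'I_3}) (i : 'I_3) :
    {set 'rV['F_3]_n} :=
  [set x | g x == i]%SET.

Definition mono_density (R : realType) n
    (g : {ffun 'rV['F_3]_n -> 'I_3}) : R :=
  \sum_(i < 3) ap3_density R (color_class g i).

(* The constant coloring only witnesses that the set of colorings is
   nonempty. *)
Definition min_mono_density (R : realType) (n : nat) : R :=
  mono_density R
    [arg min_(g < [ffun _ : 'rV['F_3]_n => ord0 : 'I_3]) mono_density R g]%O.

Definition m33_ap3 (R : realType) : R := limn (min_mono_density R).

(* Main.v *)
Require Import Defs.
From Stdlib Require Import ZArith.
From mathcomp Require Import all_boot all_order all_algebra.
From mathcomp Require Import ring zify ssrZ.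
From mathcomp Require Import all_classical all_reals all_analysis.
Import Order.TTheory GRing.Theory Num.Theory.
Import numFieldNormedType.Exports.
Local Open Scope ring_scope.

(** Count the monochromatic triples (x, x + d, x + 2d), the degenerate ones with
    d = 0 included.  In a coloring of V = F_3^n there are at least |V|^2 / 27 of
    them, with equality attained for n >= 3; the trivial triples are negligible.

    Equality: the three paraboloids x_2 + x_0^2 + x_1^2 = c partition F_3^3 into
    caps, so when coloring by the first three coordinates a triple is
    monochromatic only if d vanishes in these coordinates.

    Lower bound: let (a, b) be the colors of x + d and x + 2d relative to the
    color of x.  For suitable weights A, B, C, D of the pair (a, b), the average
    over x of
      32 (27 E_d mono - 1)
        - 9 (E_d A)^2 - 4 (E_d B)^2 - 972 (E_d C)^2 - 39 (E_d D)^2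
    is nonnegative.  Indeed, expanding the squares turns it into an average over
    x, d, e of a function of the coloring of the plane x + <d, e>; after
    symmetrizing over the nine base points and the six pairs of directions of the
    plane, that function is nonnegative at each of the 3^9 colorings of F_3^2.
    The weights and coefficients come from a semidefinite program. *)

Set Implicit Arguments.
Unset Strict Implicit.
Unset Printing Implicit Defensive.

(* The delimiter [Z] denotes the scope of MathComp's [int]. *)
Delimit Scope Z_scope with BZ.

(** * Colorings of the plane *)

Inductive color := C0 | C1 | C2.

Definition csub (a b : color) : color :=
  match b, a with
  | C0, _ => a
  | C1, C0 => C2 | C1, C1 => C0 | C1, C2 => C1
  | C2, C0 => C1 | C2, C1 => C2 | C2, C2 => C0
  end.

(* The relative colors (a, b) of the second and third points of a line. *)
Definition line_type := (color * color)%type.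

(** Replacing d by -d swaps x + d and x + 2d; symmetry in the two relative colors makes a weight
    depend only on the line through x. *)
Definition table (w00 w11 w22 w01 w02 w12 : Z) (p : line_type) : Z :=
  match p with
  | (C0, C0) => w00 | (C1, C1) => w11 | (C2, C2) => w22
  | (C0, C1) | (C1, C0) => w01
  | (C0, C2) | (C2, C0) => w02
  | (C1, C2) | (C2, C1) => w12
  end.

Local Open Scope Z_scope.

Definition mono := table 1 0 0 0 0 0.
(** Exchanging [C1] and [C2] fixes [wA] and [wB] and negates [wC] and [wD]. As tightness requires,
    all four average to 0 over d at every base point of the paraboloid coloring. *)
Definition wA := table 8 0 0 (-1) (-1) 4.
Definition wB := table 8 2 2 (-1) (-1) (-4).
Definition wC := table 0 1 (-1) 0 0 0.
Definition wD := table 0 2 (-2) 1 (-1) 0.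

Definition pair_sum (w : line_type -> Z) p1 p2 p3 p4 : Z :=
  w p1 * w p2 + w p1 * w p3 + w p1 * w p4 + w p2 * w p3 + w p2 * w p4 + w p3 * w p4.

(* A plane through x has four directions and six pairs of them, hence the
   scaling 192 = 6 * 32 and 1296 = 6 * 32 * 27 / 4. *)
Definition defect p1 p2 p3 p4 : Z :=
  1296 * (mono p1 + mono p2 + mono p3 + mono p4) - 192
  - (9 * pair_sum wA p1 p2 p3 p4 + 4 * pair_sum wB p1 p2 p3 p4
     + 972 * pair_sum wC p1 p2 p3 p4 + 39 * pair_sum wD p1 p2 p3 p4).

Definition plane_type (c : nat -> nat -> color) (i j u v : nat) : line_type :=
  (csub (c (i + u) (j + v)) (c i j), csub (c (i + u * 2) (j + v * 2)) (c i j))%N.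

Definition plane_defect_at c i j : Z :=
  defect (plane_type c i j 1 0) (plane_type c i j 0 1)
         (plane_type c i j 1 1) (plane_type c i j 1 2).

Definition plane_defect c : Z :=
  (plane_defect_at c 0 0 + (plane_defect_at c 0 1 + plane_defect_at c 0 2))
  + ((plane_defect_at c 1 0 + (plane_defect_at c 1 1 + plane_defect_at c 1 2))
     + (plane_defect_at c 2 0 + (plane_defect_at c 2 1 + plane_defect_at c 2 2))).

(* Structural recursion makes [mod3] cheap to evaluate in the 3^8 cases below. *)
Fixpoint mod3 (n : nat) : nat := match n with S (S (S m)) => mod3 m | _ => n end.

Definition lookup (s : seq color) (i j : nat) : color :=
  nth C0 (nth [::] [:: take 3 s; take 3 (drop 3 s); drop 6 s] (mod3 i)) (mod3 j).

Fixpoint all_words (k : nat) (P : seq color -> bool) : bool :=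
  match k with
  | 0%N => P [::]
  | S k => [&& all_words k (fun s => P (C0 :: s)), all_words k (fun s => P (C1 :: s))
            & all_words k (fun s => P (C2 :: s))]
  end.

(* Only relative colors matter, so the color of the origin may be fixed. *)
Lemma plane_defect_table :
  all_words 8 (fun s => Z.leb 0 (plane_defect (lookup (C0 :: s)))) = true.
Proof. by vm_compute. Qed.

Lemma mod3E n : mod3 n = (n %% 3)%N.
Proof.
elim/ltn_ind: n => -[|[|[|n]]] IHn //=.
by rewrite IHn ?(leq_addl 2 n.+1) // -[n.+3]addn3 modnDr.
Qed.

Lemma all_wordsP k P : all_words k P -> forall s, size s = k -> P s.
Proof.
elim: k P => [|k IHk] P /=; first by move=> Ps [].
by case/and3P=> P0 P1 P2 [|[] s] //= [] sz;
  [apply: (IHk _ P0) | apply: (IHk _ P1) | apply: (IHk _ P2)].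
Qed.

Lemma plane_defect_at_ext c c' i j :
  (forall u v, csub (c u v) (c i j) = csub (c' u v) (c' i j)) ->
  plane_defect_at c i j = plane_defect_at c' i j.
Proof. by move=> eqc; rewrite /plane_defect_at /plane_type !eqc. Qed.

Lemma csub_csub a b z : csub (csub a z) (csub b z) = csub a b.
Proof. by case: a b z => -[] []. Qed.

Lemma plane_defect_ge0 (c : nat -> nat -> color) :
  (forall i j, c i j = c (i %% 3)%N (j %% 3)%N) -> 0 <= plane_defect c.
Proof.
move=> per_c.
(* Subtracting the color of the origin preserves all relative colors and makes the first entry
   [C0]. *)
pose s := [seq csub (c i j) (c 0 0)%N | i <- iota 0 3, j <- iota 0 3].
have lookupE i j : lookup s i j = csub (c i j) (c 0 0)%N.
  rewrite /lookup !mod3E per_c.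
  move: (ltn_pmod i (isT : 0 < 3)%N) (ltn_pmod j (isT : 0 < 3)%N).
  by case: (i %% 3)%N => [|[|[|]]] //; case: (j %% 3)%N => [|[|[|]]].
have -> : plane_defect c = plane_defect (lookup s).
  rewrite /plane_defect !(@plane_defect_at_ext c (lookup s)) // => u v;
    by rewrite !lookupE csub_csub.
have -> : s = C0 :: behead s by rewrite /s /=; case: (c _ _).
by apply/Z.leb_le; apply: (all_wordsP plane_defect_table).
Qed.

Local Close Scope Z_scope.

(** * The lower bound *)

Section ThreeTorsion.
Variable V : finZmodType.
Hypothesis mulr3n0 : forall x : V, x *+ 3 = 0.

Lemma mulr2nN (x : V) : x *+ 2 = - x.
Proof. by apply/eqP; rewrite -subr_eq0 opprK -mulrSr mulr3n0. Qed.

Lemma mulrn_mod3 (x : V) n : x *+ n = x *+ (n %% 3).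
Proof. by rewrite {1}(divn_eq n 3) mulrnDr mulnC mulrnA mulr3n0 mul0rn add0r. Qed.

(** Any two of d, e, d + e, d + 2e are the image of (d, e) under an invertible matrix over F_3, so
    each of the six products sums to the same square; degenerate pairs leave no error term. *)
Lemma sum_pair_directions (w : line_type -> Z) (t : V -> line_type) :
  \sum_d \sum_e pair_sum w (t d) (t e) (t (d + e)) (t (d + e *+ 2))
  = (\sum_d w (t d)) ^+ 2 *+ 6.
Proof.
pose h d := w (t d).
have S1 : \sum_d \sum_e h d * h e = (\sum_d h d) ^+ 2 by rewrite expr2 big_distrlr.
have S2 : \sum_d \sum_e h d * h (d + e) = (\sum_d h d) ^+ 2.
  rewrite -S1; apply: eq_bigr => d _.
  by rewrite [RHS](reindex_inj (addrI d)).
have S3 : \sum_d \sum_e h d * h (d - e) = (\sum_d h d) ^+ 2.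
  rewrite -S1; apply: eq_bigr => d _.
  by rewrite [RHS](reindex_inj (subrI d)).
have S4 : \sum_d \sum_e h e * h (d + e) = (\sum_d h d) ^+ 2.
  rewrite exchange_big -S2 /=; apply: eq_bigr => e _.
  by apply: eq_bigr => d _; rewrite addrC.
have S5 : \sum_d \sum_e h e * h (d - e) = (\sum_d h d) ^+ 2.
  rewrite exchange_big -S1 /=; apply: eq_bigr => e _.
  by rewrite [RHS](reindex_inj (addIr (- e))).
have S6 : \sum_d \sum_e h (d + e) * h (d - e) = (\sum_d h d) ^+ 2.
  rewrite exchange_big -S3 [RHS]exchange_big /=; apply: eq_bigr => e _.
  (* After this shift of d the directions are d + 2e = d - e and d, as in [S3]. *)
  rewrite [LHS](reindex_inj (addIr e)) /=; apply: eq_bigr => d _.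
  by rewrite addrK -addrA -mulr2n mulr2nN mulrC.
have -> : \sum_d \sum_e pair_sum w (t d) (t e) (t (d + e)) (t (d + e *+ 2))
    = \sum_d \sum_e (h d * h e + h d * h (d + e) + h d * h (d - e)
        + h e * h (d + e) + h e * h (d - e) + h (d + e) * h (d - e)).
  by apply: eq_bigr => d _; apply: eq_bigr => e _; rewrite mulr2nN.
under eq_bigr => d _ do rewrite !big_split /=.
by rewrite !big_split /= S1 S2 S3 S4 S5 S6 !mulrSr mulr0n add0r.
Qed.

Lemma sum_directions (w : line_type -> Z) (t : V -> line_type) :
  \sum_d \sum_e (w (t d) + w (t e) + w (t (d + e)) + w (t (d + e *+ 2)))
  = (\sum_d w (t d)) *+ (4 * #|V|).
Proof.
pose h d := w (t d).
have S1 : \sum_d \sum_(e : V) h d = (\sum_d h d) *+ #|V|.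
  by rewrite exchange_big sumr_const.
have S2 : \sum_(d : V) \sum_e h e = (\sum_d h d) *+ #|V| by rewrite sumr_const.
have S3 : \sum_d \sum_e h (d + e) = (\sum_d h d) *+ #|V|.
  rewrite -S2; apply: eq_bigr => d _.
  by rewrite [RHS](reindex_inj (addrI d)).
have S4 : \sum_d \sum_e h (d - e) = (\sum_d h d) *+ #|V|.
  rewrite -S2; apply: eq_bigr => d _.
  by rewrite [RHS](reindex_inj (subrI d)).
have -> : \sum_d \sum_e (w (t d) + w (t e) + w (t (d + e)) + w (t (d + e *+ 2)))
    = \sum_d \sum_e (h d + h e + h (d + e) + h (d - e)).
  by apply: eq_bigr => d _; apply: eq_bigr => e _; rewrite mulr2nN.
under eq_bigr => d _ do rewrite !big_split /=.
by rewrite !big_split /= S1 S2 S3 S4 mulnC mulrnA !mulrSr mulr0n add0r.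
Qed.

(** The four squares enter with negative coefficients and are dropped; 5184 = 4 * 1296 counts the
    four directions. *)
Lemma sum_defect_le (t : V -> line_type) :
  \sum_d \sum_e defect (t d) (t e) (t (d + e)) (t (d + e *+ 2))
  <= 5184%BZ * ((\sum_d mono (t d)) *+ #|V|) - 192%BZ *+ (#|V| * #|V|).
Proof.
have -> : \sum_d \sum_e defect (t d) (t e) (t (d + e)) (t (d + e *+ 2))
  = 1296%BZ * (\sum_d \sum_e
        (mono (t d) + mono (t e) + mono (t (d + e)) + mono (t (d + e *+ 2))))
    - \sum_(d : V) \sum_(e : V) 192%BZ
    - (9%BZ * (\sum_d \sum_e pair_sum wA (t d) (t e) (t (d + e)) (t (d + e *+ 2)))
      + 4%BZ * (\sum_d \sum_e pair_sum wB (t d) (t e) (t (d + e)) (t (d + e *+ 2)))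
      + 972%BZ * (\sum_d \sum_e pair_sum wC (t d) (t e) (t (d + e)) (t (d + e *+ 2)))
      + 39%BZ * (\sum_d \sum_e pair_sum wD (t d) (t e) (t (d + e)) (t (d + e *+ 2)))).
  rewrite !mulr_sumr -!sumrB -!big_split -sumrB /=; apply: eq_bigr => d _.
  by rewrite !mulr_sumr -!sumrB -!big_split -sumrB.
rewrite sum_directions !sum_pair_directions !sumr_const -mulrnA mulnC !mulrnA.
have sq (w : line_type -> Z) : 0 <= (\sum_d w (t d)) ^+ 2 by apply: sqr_ge0.
move: (sq wA) (sq wB) (sq wC) (sq wD).
have mulrn6 (x : Z) : x *+ 6 = 6%BZ * x by rewrite -mulr_natl.
have mulrn4 (x : Z) : x *+ 4 = 4%BZ * x by rewrite -mulr_natl.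
rewrite !mulrn6 mulrn4.
move: (_ ^+ 2) (_ ^+ 2) (_ ^+ 2) (_ ^+ 2) => a b c d.
move: (_ *+ _) (_ *+ _) => m N.
lia.
Qed.

Section Coloring.
Variable g : V -> color.

Definition line_at (x u : V) : line_type :=
  (csub (g (x + u)) (g x), csub (g (x + u *+ 2)) (g x)).

Definition defect_at (x d e : V) : Z :=
  defect (line_at x d) (line_at x e) (line_at x (d + e)) (line_at x (d + e *+ 2)).

Definition plane (x d e : V) (i j : nat) : color := g (x + (d *+ i + e *+ j)).

Lemma plane_typeE x d e i j u v :
  plane_type (plane x d e) i j u v
  = line_at (x + (d *+ i + e *+ j)) (d *+ u + e *+ v).
Proof.
have planeD k : plane x d e (i + u * k)%N (j + v * k)%N
    = g (x + (d *+ i + e *+ j) + (d *+ u + e *+ v) *+ k).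
  by rewrite /plane !mulrnDr !mulrnA mulrnDl -!addrA; congr (g (_ + (_ + _))); rewrite addrCA.
by rewrite /plane_type /line_at -planeD -[in RHS](mulr1n (d *+ u + e *+ v)) -planeD !muln1.
Qed.

Lemma plane_defect_atE x d e i j :
  plane_defect_at (plane x d e) i j = defect_at (x + (d *+ i + e *+ j)) d e.
Proof.
by rewrite /plane_defect_at !plane_typeE !mulr1n !mulr0n addr0 add0r.
Qed.

Lemma plane_defectE c :
  plane_defect c = \sum_(i < 3) \sum_(j < 3) plane_defect_at c i j.
Proof. by rewrite !big_ord_recl !big_ord0 !addr0. Qed.

(** Translation by each of the nine points of the plane permutes the base points x, so symmetrizing
    costs only a factor 9. *)
Lemma sum_plane_defect d e :
  \sum_x plane_defect (plane x d e) = (\sum_x defect_at x d e) *+ 9.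
Proof.
have shift i j : \sum_x plane_defect_at (plane x d e) i j = \sum_x defect_at x d e.
  rewrite [RHS](reindex_inj (addIr (d *+ i + e *+ j))).
  by apply: eq_bigr => x _; rewrite plane_defect_atE.
under eq_bigr => x _ do rewrite plane_defectE.
rewrite exchange_big /=; under eq_bigr => i _ do
  (rewrite exchange_big; under eq_bigr => j _ do rewrite shift).
by rewrite !sumr_const !card_ord -mulrnA.
Qed.

Lemma plane_defect_plane_ge0 x d e : 0 <= plane_defect (plane x d e).
Proof.
by apply/Z.leb_le/plane_defect_ge0 => i j; rewrite /plane (mulrn_mod3 d i) (mulrn_mod3 e j).
Qed.

Lemma sum_defect_at_ge0 : 0 <= \sum_x \sum_d \sum_e defect_at x d e.
Proof.
rewrite -(pmulrn_lge0 _ (isT : 0 < 9)%N) exchange_big /= -sumrMnl.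
apply: sumr_ge0 => d _; rewrite exchange_big /= -sumrMnl.
apply: sumr_ge0 => e _; rewrite -sum_plane_defect.
by apply: sumr_ge0 => x _; apply: plane_defect_plane_ge0.
Qed.

Lemma sum_mono_ge : #|V|%:R ^+ 2 <= 27%:R * \sum_x \sum_d mono (line_at x d) :> Z.
Proof.
have := le_trans sum_defect_at_ge0 (ler_sum _ (fun x _ => sum_defect_le (line_at x))).
rewrite sumrB -mulr_sumr sumrMnl sumr_const.
set M := \sum_x _; set N := #|V| => ge0.
have N_gt0 : (0 < N)%N by apply/card_gt0P; exists 0.
(* Since 5184 = 192 * 27, the bound obtained is the claim multiplied by 192 |V|, which is
   positive. *)
have : 0 <= (27%:R * M - N%:R ^+ 2) *+ (192 * N).
  suff -> : (27%:R * M - N%:R ^+ 2) *+ (192 * N)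
      = 5184%BZ * (M *+ N) - 192%BZ *+ (N * N) *+ N by [].
  rewrite -[LHS]mulr_natl -[M *+ N]mulr_natl.
  rewrite -[_ *+ _ *+ N]mulr_natl -[_ *+ (N * N)]mulr_natl.
  rewrite !natrM expr2; move: (N%:R : Z) => k; clear -k; move: M => M.
  rewrite (_ : 192%:R = 192%BZ) // (_ : 27%:R = 27%BZ) //.
  lia.
by rewrite pmulrn_lge0 ?muln_gt0 // subr_ge0.
Qed.
End Coloring.

Definition color_of (i : 'I_3) : color := nth C0 [:: C0; C1; C2] i.

Definition mono_pairs (g : V -> 'I_3) : {set V * V} :=
  [set p | (g (p.1 + p.2) == g p.1) && (g (p.1 + p.2 *+ 2) == g p.1)]%SET.

Lemma mono_line_at (g : V -> 'I_3) x d :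
  mono (line_at (color_of \o g) x d) = ((x, d) \in mono_pairs g)%:R.
Proof.
rewrite inE /line_at /=.
by case: (g x) (g (x + d)) (g (x + d *+ 2))
  => -[|[|[|?]]] // ? [[|[|[|?]]] ?] // [[|[|[|?]]] ?].
Qed.

Lemma card_mono_pairs_ge (g : V -> 'I_3) : (#|V| ^ 2 <= 27 * #|mono_pairs g|)%N.
Proof.
rewrite -(ler_nat Z) natrX natrM.
suff <- : \sum_x \sum_d mono (line_at (color_of \o g) x d) = #|mono_pairs g|%:R.
  exact: sum_mono_ge.
under eq_bigr => x _ do under eq_bigr => d _ do rewrite mono_line_at.
rewrite pair_bigA -sum1_card natr_sum [RHS]big_mkcond /=.
by apply: eq_bigr => -[x d] _ /=; case: ifP.
Qed.
End ThreeTorsion.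

(** * Progressions in F_3^n *)

Lemma rV3_mulr3n n (x : 'rV['F_3]_n) : x *+ 3 = 0.
Proof. by rewrite -scaler_nat (_ : 3%:R = 0 :> 'F_3) ?scale0r //; apply: val_inj. Qed.

Lemma card_rV3 n : #|'rV['F_3]_n| = (3 ^ n)%N.
Proof. by rewrite card_mx card_Fp // mul1n. Qed.

(** A progression determines its first term and its difference. *)
Lemma card_ap3 n (T : {set 'rV['F_3]_n}) :
  #|ap3 T| = #|[set p : 'rV['F_3]_n * 'rV['F_3]_n |
     [&& p.2 != 0, p.1 \in T, p.1 + p.2 \in T & p.1 + p.2 *+ 2 \in T]]%SET|.
Proof.
pose f (p : 'rV['F_3]_n * 'rV['F_3]_n) := (p.1, p.1 + p.2, p.1 + p.2 *+ 2).
have f_inj : injective f by move=> [a d] [b e] [-> /addrI ->].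
rewrite -(card_imset _ f_inj); congr #|pred_of_set _|; apply/setP => t.
apply/idP/imsetP => [|[[a d]]].
  rewrite inE => /andP[tT /existsP[a /existsP[d /andP[d0 /eqP t_eq]]]].
  move: tT; rewrite t_eq !inE /= => /andP[/andP[aT adT] addT]; exists (a, d) => //.
  by rewrite inE /= d0 aT adT.
rewrite inE /= => /and4P[d0 aT adT addT] ->; rewrite !inE /= aT adT addT /=.
by apply/existsP; exists a; apply/existsP; exists d; rewrite d0 eqxx.
Qed.

Lemma card_ap3_setT n : (#|ap3 [set: 'rV['F_3]_n]%SET| + 3 ^ n = 9 ^ n)%N.
Proof.
rewrite card_ap3 -card_rV3 (_ : 9 = 3 * 3)%N // expnMn -card_rV3 -card_prod.
rewrite -(cardC [pred p : 'rV['F_3]_n * 'rV['F_3]_n | p.2 != 0]); congr addn.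
  by apply: eq_card => p; rewrite !inE !andbT.
rewrite -(@card_imset _ _ (fun x : 'rV['F_3]_n => (x, 0 : 'rV['F_3]_n)));
    last by move=> x y [].
apply: eq_card => -[a d]; rewrite !inE negbK /=.
apply/imsetP/eqP => [[x _ [_ ->]]|->] //.
by exists a.
Qed.

(** The 3^n pairs with zero difference are always monochromatic; the others are sorted by the color
    of their first point. *)
Lemma sum_card_ap3_color_class n (g : {ffun 'rV['F_3]_n -> 'I_3}) :
  (\sum_(i < 3) #|ap3 (color_class g i)| + 3 ^ n = #|mono_pairs g|)%N.
Proof.
rewrite -card_rV3.
rewrite -(cardID [pred p : 'rV['F_3]_n * 'rV['F_3]_n | p.2 == 0] (mono_pairs g)) addnC.
congr addn.
  rewrite -(@card_imset _ _ (fun x : 'rV['F_3]_n => (x, 0 : 'rV['F_3]_n)));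
    last by move=> x y [].
  apply: eq_card => -[a d]; rewrite !inE /=.
  apply/imsetP/andP => [[x _ [-> ->]]|[_ /eqP->]]; last by exists a.
  by rewrite !mul0rn !addr0 !eqxx.
rewrite -[RHS]sum1_card (partition_big (fun p => g p.1) xpredT) //=.
apply: eq_bigr => i _; rewrite sum1_card card_ap3; apply: eq_card => -[a d].
rewrite !inE /= unfold_in /= !inE /=.
case: (d == 0) => //=.
by case: (g a =P i) => [->|]; rewrite ?andbT ?andbF.
Qed.

(** * The extremal coloring by paraboloids *)

Definition paraboloid (u : 'rV['F_3]_3) : 'F_3 :=
  u 0 0 ^+ 2 + u 0 1 ^+ 2 + u 0 (2%:R).

(** This holds because -1 is not a square modulo 3. *)
Lemma F3_sum_sqr_eq0 (x y : 'F_3) : x ^+ 2 + y ^+ 2 = 0 -> x = 0 /\ y = 0.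
Proof.
by case: x y => -[|[|[|?]]] // ? [[|[|[|?]]] ?] // /(congr1 val) // _; split; apply: val_inj.
Qed.

Lemma paraboloid_line (u w : 'rV['F_3]_3) :
  (paraboloid (u + w) == paraboloid u) && (paraboloid (u + w *+ 2) == paraboloid u)
  = (w == 0).
Proof.
apply/andP/eqP => [[/eqP eq1 /eqP eq2]|->]; last by rewrite mul0rn addr0.
have char3 : 3%:R = 0 :> 'F_3 by apply: val_inj.
move: eq1 eq2; rewrite /paraboloid !mxE => eq1 eq2.
have /F3_sum_sqr_eq0[w0 w1] : w 0 0 ^+ 2 + w 0 1 ^+ 2 = 0.
  move: (u 0 0) (u 0 1) (u 0 2%:R) (w 0 0) (w 0 1) (w 0 2%:R) eq1 eq2 => a b c x y z eq1 eq2.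
  (* The second difference of the paraboloid along w is 2 (x^2 + y^2), which equals -(x^2 + y^2)
     modulo 3. *)
  have -> : x ^+ 2 + y ^+ 2 = 3%:R * (x ^+ 2 + y ^+ 2)
    - (((a + (x + x)) ^+ 2 + (b + (y + y)) ^+ 2 + (c + (z + z)) - (a ^+ 2 + b ^+ 2 + c))
       - 2%:R * ((a + x) ^+ 2 + (b + y) ^+ 2 + (c + z) - (a ^+ 2 + b ^+ 2 + c))) by ring.
  by rewrite eq1 eq2 char3 subrr mulr0 mul0r !subr0.
have w2 : w 0 (2%:R) = 0.
  by move: eq1; rewrite w0 w1 !addr0 => /addrI; rewrite -[RHS]addr0 => /addrI.
apply/rowP => i; rewrite mxE.
by case: i => -[|[|[|?]]] // ?;
  [rewrite -[RHS]w0 | rewrite -[RHS]w1 | rewrite -[RHS]w2]; congr (w _ _); apply: val_inj.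
Qed.

Lemma exists_27_mono_pairs m :
  exists g : {ffun 'rV['F_3]_(3 + m) -> 'I_3}, (27 * #|mono_pairs g| = 9 ^ (3 + m))%N.
Proof.
(* The type ['F_3] is convertible to ['I_3], so field values serve as colors. The monochromatic
   differences are those with first three coordinates zero. *)
exists [ffun v => paraboloid (lsubmx v) : 'I_3].
have -> : mono_pairs [ffun v : 'rV['F_3]_(3 + m) => paraboloid (lsubmx v) : 'I_3]
    = finset.setX [set: 'rV['F_3]_(3 + m)]%SET
        [set row_mx 0 w | w in [set: 'rV['F_3]_m]%SET]%SET.
  apply/setP => -[v w]; rewrite !inE !ffunE /= !raddfD /= -mulr2n.
  rewrite paraboloid_line; apply/eqP/imsetP => [w0|[w' _ ->]]; last by rewrite row_mxKl.
  by exists (rsubmx w); rewrite ?inE // -[LHS]hsubmxK w0.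
rewrite cardsX cardsT card_imset; last by move=> x y /eq_row_mx[].
rewrite cardsT !card_rV3 (_ : 27 = 3 ^ 3)%N // mulnCA -expnD -expnD addnn -mul2n expnM //.
Qed.

(** * The minimum density and its limit *)

Section Density.
Variable R : realType.

(** This includes n = 0, where both denominators vanish and both sides are 0. *)
Lemma mono_densityE n (g : {ffun 'rV['F_3]_n -> 'I_3}) :
  mono_density R g = (#|mono_pairs g|%:R - (3 ^ n)%:R) / ((9 ^ n)%:R - (3 ^ n)%:R).
Proof.
rewrite /mono_density /ap3_density -mulr_suml -natr_sum.
by rewrite -sum_card_ap3_color_class -(card_ap3_setT n) !natrD !addrK.
Qed.

Lemma min_mono_densityE m :
  min_mono_density R (3 + m)
  = ((9 ^ (3 + m))%:R / 27%:R - (3 ^ (3 + m))%:R) / ((9 ^ (3 + m))%:R - (3 ^ (3 + m))%:R).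
Proof.
set n := (3 + m)%N.
have den_ge0 : 0 <= ((9 ^ n)%:R - (3 ^ n)%:R)^-1 :> R.
  by rewrite invr_ge0 subr_ge0 ler_nat leq_exp2r.
have low (g : {ffun 'rV['F_3]_n -> 'I_3}) :
  ((9 ^ n)%:R / 27%:R - (3 ^ n)%:R) / ((9 ^ n)%:R - (3 ^ n)%:R) <= mono_density R g.
  rewrite mono_densityE ler_wpM2r // lerB // ler_pdivrMr // -natrM ler_nat mulnC.
  apply: leq_trans (card_mono_pairs_ge (@rV3_mulr3n n) g).
  by rewrite card_rV3 -expnM mulnC expnM.
have [g0 g0E] := exists_27_mono_pairs m.
apply/le_anti/andP; split; last exact: low.
rewrite /min_mono_density; case: arg_minP => //= g _ /(_ g0 isT) /le_trans; apply.
by rewrite mono_densityE -g0E natrM mulrAC divff ?pnatr_eq0 // mul1r.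
Qed.

Lemma cvg_min_mono_density : (min_mono_density R @ \oo --> (1 / 27 : R))%classic.
Proof.
(* The exact value is available only from dimension 3 on. *)
rewrite -(cvg_shiftn 3).
(* Numerator and denominator are divided by 9^n, leaving powers of 1/3 that tend to 0. *)
have -> : (fun m => min_mono_density R (m + 3))
    = (fun m => (27%:R^-1 - 3%:R^-1 ^+ (m + 3)) / (1 - 3%:R^-1 ^+ (m + 3))).
  apply/funext => m; rewrite addnC min_mono_densityE.
  set n := (3 + m)%N.
  have x_neq0 : (3 ^ n)%:R != 0 :> R by rewrite pnatr_eq0 expn_eq0.
  rewrite exprVn -natrX (_ : 9 = 3 * 3)%N // expnMn natrM.
  set x := (3 ^ n)%:R in x_neq0 *.
  have x_gt1 : 1 < x by rewrite ltr1n -(expn0 3) ltn_exp2l.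
  have x1_neq0 : x - 1 != 0 by rewrite subr_eq0 gt_eqF.
  have xx_neq0 : x * x - x != 0 by rewrite -[X in _ - X]mulr1 -mulrBr mulf_neq0.
  by field; apply/and3P.
rewrite (cvg_shiftn 3 (fun n => (27%:R^-1 - 3%:R^-1 ^+ n) / (1 - 3%:R^-1 ^+ n) : R)).
have pow0 : ((fun n => 3%:R^-1 ^+ n : R) @ \oo --> (0 : R))%classic.
  by apply: cvg_expr; rewrite ger0_norm ?invf_lt1 ?ltr1n.
have -> : 1 / 27 = (27%:R^-1 - 0) / (1 - 0) :> R by rewrite !subr0 divr1 div1r.
apply: cvgM; first by apply: cvgB => //; apply: cvg_cst.
by apply: cvgV; [rewrite subr0 oner_neq0 | apply: cvgB => //; apply: cvg_cst].
Qed.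
End Density.

Theorem theorem1p2 (R : realType) :
  cvgn (min_mono_density R) /\ m33_ap3 R = 1 / 27.
Proof.
have cvg_min := @cvg_min_mono_density R.
by split; [apply/cvg_ex; exists (1 / 27) | apply: cvg_lim].
Qed.
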